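(* Let $\boldsymbol N\in\mathbb N^d$ have all components odd, let $\boldsymbol M\in\mathbb N^d$ satisfy $M_\alpha\ge2N_\alpha-1$ for all $\alpha$, and let $\boldsymbol P\in\mathbb N^d$. Let $\psi\in L^\infty_\#(\mathcal Y;\mathbb R)$, let $C^p_{\boldsymbol P}\in\mathbb R^{d\times d}$ for $p\in\mathbb Z^d_{\boldsymbol P}$, and let $$A(x)=\sum_{p\in\mathbb Z^d_{\boldsymbol P}}\psi(x-x^p_{\boldsymbol P})\,C^p_{\boldsymbol P},\qquad x\in\mathcal Y.$$ Then the matrix $\mathsf A_{\boldsymbol M}$ with components $(\mathsf A_{\boldsymbol M})^{kl}_{\alpha\beta}=\delta_{kl}\sum_{n\in\mathbb Z^d_{2\boldsymbol N-\boldsymbol 1}}\omega^{kn}_{\boldsymbol M}\hat A_{\alpha\beta}(n)$ is given by $$(\mathsf A_{\boldsymbol M})^{kl}_{\alpha\beta}=\delta_{kl}\,|\boldsymbol P|\sum_{m\in\mathbb Z^d_{2\boldsymbol N-\boldsymbol 1}}\omega^{km}_{\boldsymbol M}\,\hat\psi(m)\Bigl(\sum_{p\in\mathbb Z^d_{\boldsymbol P}}\frac{\omega_{\boldsymbol P}^{-mp}}{|\boldsymbol P|}\,C^p_{\boldsymbol P,\alpha\beta}\Bigr)$$ for $k,l\in\mathbb Z^d_{\boldsymbol M}$ and $\alpha,\beta=1,\dots,d$.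
   Context: Let $d\in\{2,3\}$, $\mathcal Y=(-\tfrac12,\tfrac12)^d$; $L^\infty_\#(\mathcal Y;X)$ is the space of essentially bounded $\mathcal Y$-periodic (period lattice $\mathbb Z^d$) $X$-valued functions. $\varphi_k(x)=\exp(2\pi i\,k\cdot x)$ and $\hat f(k)=\int_{\mathcal Y}f(x)\varphi_{-k}(x)\,dx$ for $k\in\mathbb Z^d$ (entrywise for matrix-valued $f$). For $\boldsymbol M\in\mathbb N^d$: $\mathbb Z^d_{\boldsymbol M}=\{k\in\mathbb Z^d:-M_\alpha/2\le k_\alpha<M_\alpha/2\}$; $|\boldsymbol M|=\prod_\alpha M_\alpha$; $\omega_{\boldsymbol M}^{kn}=\exp(2\pi i\sum_\alpha k_\alpha n_\alpha/M_\alpha)$ for $k,n\in\mathbb Z^d$ (and $\omega_{\boldsymbol M}^{-kn}=\omega_{\boldsymbol M}^{(-k)n}$); grid points $x^m_{\boldsymbol M}=(m_\alpha/M_\alpha)_\alpha$, $m\in\mathbb Z^d_{\boldsymbol M}$; likewise with $\boldsymbol P$ in place of $\boldsymbol M$. $2\boldsymbol N-\boldsymbol 1=(2N_\alpha-1)_\alpha$. $C^p_{\boldsymbol P,\alpha\beta}$ denotes the $(\alpha,\beta)$ entry of $C^p_{\boldsymbol P}$. *)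

(* Defs.v *)
From HB Require Import structures.
From mathcomp Require Import all_boot all_order all_algebra.
From mathcomp Require Import all_classical all_reals all_analysis.
From mathcomp Require Import complex zify.

Set Implicit Arguments.
Unset Strict Implicit.
Unset Printing Implicit Defensive.

Import Order.TTheory GRing.Theory Num.Theory.
Import numFieldNormedType.Exports.

Local Open Scope classical_set_scope.
Local Open Scope ring_scope.

Section tuple_measure.
Context {dT : measure_display} {T : measurableType dT} {R : realType}.

Section step.
Context {n : nat}.
Variable m1 : {sigma_finite_measure set T -> \bar R}.
Variable m2 : {sigma_finite_measure set (n.-tuple T) -> \bar R}.

Definition tcons (xt : T * n.-tuple T) : n.+1.-tuple T :=
  [tuple of xt.1 :: xt.2].

Lemma measurable_tcons : measurable_fun [set: T * n.-tuple T] tcons.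
Proof. exact: measurable_cons. Qed.

Lemma preimage_tcons (A : set (n.+1.-tuple T)) : measurable A ->
  measurable (tcons @^-1` A).
Proof.
by move=> mA; rewrite -[X in measurable X]setTI; exact: measurable_tcons.
Qed.

Definition cons_measure : set (n.+1.-tuple T) -> \bar R :=
  pushforward (m1 \x m2)%E tcons.

Let cons_measure0 : cons_measure set0 = 0%E.
Proof. by rewrite /cons_measure /pushforward preimage_set0 measure0. Qed.

Let cons_measure_ge0 A : (0 <= cons_measure A)%E.
Proof. by rewrite /cons_measure /pushforward measure_ge0. Qed.

Let cons_measure_sigma_additive : semi_sigma_additive cons_measure.
Proof.
move=> F mF tF mUF; rewrite /cons_measure /pushforward preimage_bigcup.
apply: measure_semi_sigma_additive.
- by move=> k; exact: preimage_tcons.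
- apply/trivIsetP => /= i j _ _ ij; rewrite -preimage_setI.
  by move/trivIsetP : tF => /(_ _ _ _ _ ij) ->//; rewrite preimage_set0.
- by rewrite -preimage_bigcup; exact: preimage_tcons.
Qed.

HB.instance Definition _ := isMeasure.Build _ _ _ cons_measure
  cons_measure0 cons_measure_ge0 cons_measure_sigma_additive.

Let cons_measure_sigma_finite : sigma_finite setT cons_measure.
Proof.
have /sigma_finiteP[F [TF ndF Foo]] := sigma_finiteT m1.
have /sigma_finiteP[G [TG ndG Goo]] := sigma_finiteT m2.
pose uncons (t : n.+1.-tuple T) := (thead t, [tuple of behead t]).
have muncons : measurable_fun setT uncons.
  apply/measurable_fun_pairP; split.
    exact: (@measurable_tnth _ T n.+1 ord0).
  exact: measurable_behead.
have consK xt : uncons (tcons xt) = xt.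
  by case: xt => x t; rewrite /uncons theadE; congr pair; exact: val_inj.
exists (fun k => uncons @^-1` (F k `*` G k)).
  apply/seteqP; split => [t _|]; last exact: subsetT.
  have [i _ Fi] : (\bigcup_i F i) (uncons t).1 by rewrite -TF.
  have [j _ Gj] : (\bigcup_i G i) (uncons t).2 by rewrite -TG.
  exists (maxn i j) => //; split.
  - by move: Fi; exact/subsetPset/ndF/leq_maxl.
  - by move: Gj; exact/subsetPset/ndG/leq_maxr.
move=> k; have [? ?] := Foo k; have [? ?] := Goo k; split.
  by rewrite -[X in measurable X]setTI; apply: muncons => //; exact: measurableX.
rewrite /cons_measure /pushforward -comp_preimage.
rewrite (_ : uncons \o tcons = id); last exact/funext.
by rewrite preimage_id product_measure1E// lte_mul_pinfty// ge0_fin_numE.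
Qed.

HB.instance Definition _ := Measure_isSigmaFinite.Build _ _ _ cons_measure
  cons_measure_sigma_finite.

End step.

(* The n-fold product measure m \x ... \x m, transported to n.-tuple T. *)
Fixpoint tuple_measure (m : {sigma_finite_measure set T -> \bar R}) (n : nat) :
    {sigma_finite_measure set (n.-tuple T) -> \bar R} :=
  match n with
  | 0 => \d_([tuple])
  | n'.+1 => cons_measure m (tuple_measure m n')
  end.

End tuple_measure.

Lemma tuple_measure_box {dT : measure_display} {T : measurableType dT}
    {R : realType} (m : {sigma_finite_measure set T -> \bar R}) (n : nat)
    (A : 'I_n -> set T) (mA : forall i, measurable (A i)) :
  tuple_measure m n [set t | forall i, A i (tnth t i)] =
  (\prod_(i < n) m (A i))%E.
Proof.
elim: n A mA => [|n IHn] A mA /=.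
  by rewrite big_ord0 diracE mem_set//= => -[].
rewrite big_ord_recl -IHn//= /cons_measure /pushforward.
rewrite -product_measure1E//.
  congr ((_ \x _)%E _); apply/seteqP; split => [[x t]/= At|[x t]/= [Ax At] i].
    split=> [|i]; first by have := At ord0; rewrite tnth0.
    by have := At (lift ord0 i); rewrite tnthS.
  by case: (unliftP ord0 i) => [j ->|->]; rewrite ?tnthS ?tnth0.
rewrite (_ : [set t | _] =
    \bigcap_(i in [set: 'I_n]) ((tnth (T:=T))^~ i @^-1` A (lift ord0 i))).
  apply: fin_bigcap_measurable => // i _.
  by rewrite -[X in measurable X]setTI; exact: measurable_tnth.
by apply/seteqP; split => [t At i _|t At i]; [exact: At|exact: At].
Qed.

(* R^d, with the product of the Borel sigma-algebras. *)
Notation pointR R d := (d.-tuple (measurableTypeR R)).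

Definition lebesgue_tuple {R : realType} (d : nat) :
    {sigma_finite_measure set (pointR R d) -> \bar R} :=
  tuple_measure (@lebesgue_measure R) d.

Section fourier.
Context {R : realType} {d : nat}.
Local Open Scope complex_scope.

Implicit Types (x y : pointR R d) (k l m n : 'rV[int]_d) (M N : 'I_d -> nat).

Definition xcoord x (a : 'I_d) : R := tnth x a.

Definition cell : set (pointR R d) :=
  [set x | forall a, - (1 / 2) < xcoord x a < 1 / 2].

Definition tsub x y : pointR R d := [tuple xcoord x a - xcoord y a | a < d].

Definition translate x k : pointR R d :=
  [tuple xcoord x a + (k 0 a)%:~R | a < d].

(* Representatives of the elements of L^oo_#(Y; R). These elements are classes
   modulo equality almost everywhere, so periodicity is only required almost
   everywhere; each class has a Borel representative. By periodicity, the
   essential supremum over R^d is the one over the cell. *)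
Definition Linfty_per (f : pointR R d -> R) : Prop :=
  [/\ measurable_fun setT f,
      finite_norm (lebesgue_tuple d) +oo%E f &
      forall k, {ae lebesgue_tuple d, forall x, f (translate x k) = f x}].

Definition cexp (z : R[i]) : R[i] :=
  (expR (complex.Re z))%:C * (cos (complex.Im z) +i* sin (complex.Im z)).

Definition cintegral (D : set (pointR R d)) (f : pointR R d -> R[i]) : R[i] :=
  (\int[lebesgue_tuple d]_(x in D) complex.Re (f x)) +i*
  (\int[lebesgue_tuple d]_(x in D) complex.Im (f x)).

Definition phi k x : R[i] :=
  cexp (2 * pi%:C * 'i * (\sum_a (k 0 a)%:~R * xcoord x a)%:C).

Definition fourier (f : pointR R d -> R[i]) k : R[i] :=
  cintegral cell (fun x => f x * phi (- k) x).

Definition fourier_mx (A : pointR R d -> 'M[R]_d) k : 'M[R[i]]_d :=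
  \matrix_(a, b) fourier (fun x => (A x a b)%:C) k.

Definition Zgrid M : set 'rV[int]_d :=
  [set k : 'rV[int]_d | forall a,
    - ((M a)%:R / 2) <= (k 0 a)%:~R :> rat /\
    (k 0 a)%:~R < (M a)%:R / 2 :> rat].

(* Hence the sums \sum_(k \in Zgrid M) below are genuine finite sums. *)
Lemma finite_Zgrid M : finite_set (Zgrid M).
Proof.
pose B := \max_a M a.
pose g (f : {ffun 'I_d -> 'I_(B + B).+1}) : 'rV[int]_d :=
  \row_a ((f a)%:Z - B%:Z).
apply: (@sub_finite_set _ _ (g @` setT)); last exact: finite_image.
move=> k Mk; exists [ffun a : 'I_d => inord `|(k ord0 a + B%:Z)%R|%N] => //.
apply/rowP => a; rewrite mxE ffunE.
have [k1 k2] := Mk a.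
have MB : (M a <= B)%N by exact: leq_bigmax.
have h1 : - (M a)%:Z <= k 0 a.
  rewrite -(ler_int rat) rmorphN/=; apply: le_trans k1.
  by rewrite lerN2 ler_pdivrMr// ler_peMr// ler1n.
have h2 : k 0 a <= (M a)%:Z.
  rewrite -(ler_int rat); apply: (le_trans (ltW k2)).
  by rewrite ler_pdivrMr// ler_peMr// ler1n.
have hB : 0 <= k ord0 a + B%:Z /\ k ord0 a + B%:Z <= (B + B)%N%:Z.
  clear -h1 h2 MB; clearbody B; move: (k ord0 a) (M a) h1 h2 MB => u v; lia.
case: hB => hB0 hB1.
rewrite inordK; first by rewrite gez0_abs// addrK.
by rewrite ltnS -lez_nat gez0_abs.
Qed.

Definition msize M : nat := \prod_a M a.

Definition omega M k n : R[i] :=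
  cexp (2 * pi%:C * 'i * (\sum_a (k 0 a * n 0 a)%:~R / (M a)%:R)%:C).

Definition gridpt M m : pointR R d := [tuple (m 0 a)%:~R / (M a)%:R | a < d].

(* The truncated subtraction is exact, as this is only used with N a > 0. *)
Definition twoN1 N : 'I_d -> nat := fun a => (2 * N a - 1)%N.

Definition A_M N M (A : pointR R d -> 'M[R]_d) k l (a b : 'I_d) : R[i] :=
  (k == l)%:R *
  \sum_(n \in Zgrid (twoN1 N)) omega M k n * fourier_mx A n a b.

End fourier.

(* Main.v *)
Require Import Defs.
From mathcomp Require Import all_boot all_order all_algebra.
From mathcomp Require Import all_classical all_reals all_analysis.
From mathcomp Require Import measurable_realfun ess_sup_inf complex ring lra.

(* Both sides reduce to the shift rule: the n-th Fourier coefficient of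
   psi(. - y) is phi_{-n}(y) times that of psi. Since psi is only periodic
   almost everywhere, the shift rule is proved through the interval exchange of
   [-1/2, 1/2)^d that represents x |-> x - y modulo Z^d: coordinatewise it is a
   pair of translations, so it preserves the Lebesgue measure on boxes, hence
   everywhere. *)

Set Implicit Arguments.
Unset Strict Implicit.
Unset Printing Implicit Defensive.

Import Order.TTheory GRing.Theory Num.Theory.
Import numFieldNormedType.Exports.

Local Open Scope classical_set_scope.
Local Open Scope ring_scope.
Local Open Scope complex_scope.

(** * Uniqueness of product measures and coordinatewise maps *)

Section tuple_measure_preserving.
Context {dT : measure_display} {T : measurableType dT} {R : realType}.
Variables (m : {sigma_finite_measure set T -> \bar R}) (n : nat).

Definition box (A : 'I_n -> set T) : set (n.-tuple T) :=
  [set t | forall i, A i (tnth t i)].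

Lemma measurable_box (A : 'I_n -> set T) :
  (forall i, measurable (A i)) -> measurable (box A).
Proof.
move=> mA.
rewrite (_ : box A = \bigcap_(i in [set: 'I_n]) ((tnth (T:=T))^~ i @^-1` A i)).
  apply: fin_bigcap_measurable => // i _.
  by rewrite -[X in measurable X]setTI; exact: measurable_tnth.
by apply/seteqP; split => [t At i _|t At i]; exact: At.
Qed.

(** Boxes are stable under intersection and generate the product sigma-algebra, and the cubes over
    an increasing exhaustion of [T] by sets of finite measure exhaust the tuples, so two measures
    that agree on boxes coincide. *)
Lemma tuple_measure_unique (nu : {measure set (n.-tuple T) -> \bar R}) :
  (forall A : 'I_n -> set T, (forall i, measurable (A i)) ->
    nu (box A) = (\prod_(i < n) m (A i))%E) ->
  forall B, measurable B -> nu B = tuple_measure m n B.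
Proof.
move=> nuE B mB.
have /sigma_finiteP[F [TF ndF Foo]] := sigma_finiteT m.
pose G := [set B | exists2 A : 'I_n -> set T, (forall i, measurable (A i)) &
  B = box A].
apply: (@measure_unique _ _ _ G (fun k => box (fun=> F k))) => //.
- apply/seteqP; split.
    apply: smallest_sub; first exact: smallest_sigma_algebra.
    rewrite -bigcup_seq/= => C [i _ [A mA <-]]; rewrite setTI.
    apply: sub_sigma_algebra.
    (* A generator of the product sigma-algebra constrains one coordinate: it is a box whose other
       sides are [setT]. *)
    exists (fun j => if j == i then A else setT); first by move=> j; case: ifP.
    apply/seteqP; split => [t At j|t /(_ i)]; last by rewrite eqxx.
    by case: eqP => [->|].
  apply: smallest_sub; first exact: sigma_algebra_measurable.
  by move=> C [A mA ->]; exact: measurable_box.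
- move=> _ _ [A mA ->] [A' mA' ->]; exists (fun i => A i `&` A' i).
    by move=> i; exact: measurableI.
  apply/seteqP; split => [t [At A't] i|t At]; first by split.
  by split => i; have [] := At i.
- by move=> k; exists (fun=> F k) => // _; have [] := Foo k.
- apply/seteqP; split => // t _.
  have /choice[f Ff] : forall i, exists k, F k (tnth t i).
    by move=> i; have [k _ Fk] : (\bigcup_i F i) (tnth t i); [rewrite -TF|exists k].
  (* As [F] increases, the largest of the indices serves all coordinates at once. *)
  exists (\max_i f i)%N => // i.
  by move: (Ff i); exact/subsetPset/ndF/leq_bigmax.
- by move=> _ [A mA ->]; rewrite nuE//; exact/esym/tuple_measure_box.
- move=> k; rewrite nuE; last by move=> _; have [] := Foo k.
  have [mF Fk] := Foo k.
  have mFk : m (F k) \is a fin_num by rewrite ge0_fin_numE.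
  by rewrite ltey_eq prode_fin_num.
Qed.

(** The preimage of a box under a coordinatewise map is the box of the preimages, so the pushforward
    has the right value on boxes and uniqueness applies. *)
Lemma tuple_measure_map (f : 'I_n -> T -> T)
    (mf : forall i, measurable_fun [set: T] (f i)) :
  (forall i A, measurable A -> m (f i @^-1` A) = m A) ->
  let F := fun t : n.-tuple T => [tuple f i (tnth t i) | i < n] in
  measurable_fun [set: n.-tuple T] F /\
  (forall B, measurable B -> tuple_measure m n (F @^-1` B) = tuple_measure m n B).
Proof.
move=> fm F.
have mF : measurable_fun [set: n.-tuple T] F.
  apply/measurable_fun_tnthP => i.
  rewrite (_ : _ \o _ = f i \o (@tnth n T ^~ i)); last first.
    by apply/funext => t /=; rewrite tnth_mktuple.
  by apply: measurableT_comp => //; exact: measurable_tnth.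
split=> // B mB.
apply: (tuple_measure_unique (nu := pushforward (tuple_measure m n) F)) => //.
move=> A mA; rewrite /= /pushforward.
rewrite (_ : F @^-1` _ = box (fun i => f i @^-1` A i)).
  rewrite [LHS]tuple_measure_box; last first.
    by move=> i; rewrite -[X in measurable X]setTI; exact: mf.
  by apply: eq_bigr => i _; rewrite fm.
by apply/seteqP; split => t At i; have := At i; rewrite /= tnth_mktuple.
Qed.

End tuple_measure_preserving.

(** * Lebesgue measure under translation and under an exchange of two intervals *)

Section interval_exchange.
Context {R : realType}.
Local Notation mu := (@lebesgue_measure R).
Implicit Types (s c : R) (A : set (measurableTypeR R)).

Lemma measurable_shift c :
  measurable_fun [set: measurableTypeR R] (fun x : measurableTypeR R => x + c).
Proof. exact: measurable_funD. Qed.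

Lemma lebesgue_measure_shift c A : measurable A ->
  mu ((fun x => x + c) @^-1` A) = mu A.
Proof.
move=> mA; have mf := measurable_shift c.
apply/esym.
apply: (lebesgue_measure_unique (mu := pushforward mu
  ((fun x => x + c) : _ -> measurableTypeR R))) => //= _ [[a b]] _ <-.
rewrite /pushforward (_ : _ @^-1` _ = `]a - c, b - c]%classic); last first.
  by apply/seteqP; split => x /=; rewrite !in_itv/= ltrBlDr lerBrDr.
rewrite !lebesgue_measure_itv/= !lte_fin ltrD2r.
by case: ifPn => // _; rewrite -!EFinB; congr EFin; ring.
Qed.

(* Translation by [- s] modulo 1 on [-1/2, 1/2), for [0 <= s < 1]. Keeping the
   other points fixed makes it preserve the Lebesgue measure of the whole
   line, so that no restricted measure is needed. *)
Definition circle_shift s (x : R) : R :=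
  if x \in `[- (1 / 2), - (1 / 2) + s[ then x + (1 - s)
  else if x \in `[- (1 / 2) + s, 1 / 2[ then x + - s else x.

Lemma measurable_circle_shift s :
  measurable_fun [set: measurableTypeR R]
    (circle_shift s : measurableTypeR R -> measurableTypeR R).
Proof.
have mitv (i : interval R) : measurable_fun [set: R] (fun x => x \in i).
  apply: (measurable_fun_bool true); rewrite setTI.
  rewrite (_ : _ @^-1` _ = [set` i]); first exact: measurable_itv.
  by apply/seteqP; split => x.
apply: measurable_fun_ifT; [exact: mitv|exact: measurable_shift|].
by apply: measurable_fun_ifT; [exact: mitv|exact: measurable_shift|].
Qed.

Lemma circle_shift_half_open s x : 0 <= s < 1 ->
  (circle_shift s x \in `[- (1 / 2), 1 / 2[) = (x \in `[- (1 / 2), 1 / 2[).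
Proof.
move=> /andP[s0 s1]; rewrite /circle_shift !in_itv/=.
by case: ifPn => [/andP[? ?]|]; [|case: ifPn => // /andP[? ?] _];
  apply/idP/idP => /andP[? ?]; apply/andP; split; lra.
Qed.

Lemma circle_shift_congr s x : x \in `[- (1 / 2), 1 / 2[ ->
  exists z : int, circle_shift s x = x - s + z%:~R.
Proof.
rewrite /circle_shift !in_itv/= => /andP[x1 x2].
case: ifPn => [_|]; first by exists 1; ring.
rewrite x1 x2/= andbT -leNgt => ->; exists 0; ring.
Qed.

(** [J1] and [J2] are the images of [I1] and [I2] under their translations, and the points of [K]
    are fixed. Both triples partition the line, so translation invariance can be applied piece by
    piece. *)
Lemma lebesgue_measure_circle_shift s A : 0 <= s < 1 -> measurable A ->
  mu (circle_shift s @^-1` A) = mu A.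
Proof.
move=> /andP[s0 s1] mA.
pose I1 := `[- (1 / 2), - (1 / 2) + s[%classic : set (measurableTypeR R).
pose I2 := `[- (1 / 2) + s, 1 / 2[%classic : set (measurableTypeR R).
pose J1 := `[1 / 2 - s, 1 / 2[%classic : set (measurableTypeR R).
pose J2 := `[- (1 / 2), 1 / 2 - s[%classic : set (measurableTypeR R).
pose K := ~` `[- (1 / 2), 1 / 2[%classic : set (measurableTypeR R).
have mI1 : measurable I1 by exact: measurable_itv.
have mI2 : measurable I2 by exact: measurable_itv.
have mJ1 : measurable J1 by exact: measurable_itv.
have mJ2 : measurable J2 by exact: measurable_itv.
have mK : measurable K by apply: measurableC; exact: measurable_itv.
have mS c B : measurable B ->
    measurable ((fun x : measurableTypeR R => x + c) @^-1` B).
  by move=> mB; rewrite -[X in measurable X]setTI; exact: measurable_shift.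
have muU3 (B1 B2 B3 : set (measurableTypeR R)) : measurable B1 ->
    measurable B2 -> measurable B3 -> B1 `&` B2 = set0 ->
    (B1 `|` B2) `&` B3 = set0 ->
    mu (B1 `|` B2 `|` B3) = (mu B1 + mu B2 + mu B3)%E.
  move=> m1 m2 m3 d12 d3; rewrite measureU//; last exact: measurableU.
  by rewrite measureU.
(* The preimage is cut according to which branch of [circle_shift] is taken, each piece being
   described by its image. *)
have -> : circle_shift s @^-1` A =
    (fun x => x + (1 - s)) @^-1` (A `&` J1) `|`
    (fun x => x + - s) @^-1` (A `&` J2) `|` (A `&` K).
  apply/seteqP; split=> x; rewrite /circle_shift /J1 /J2 /K /= !in_itv/=.
    case: ifPn => [/andP[? ?]|n1]; last case: ifPn => [/andP[? ?]|n2].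
    - by left; left; split => //; apply/andP; split; lra.
    - by left; right; split => //; apply/andP; split; lra.
    - move=> Ax; right; split => //.
      by case/andP => ? ?; case/negP: n1; apply/andP; split => //;
        rewrite ltNge; apply/negP => ?; case/negP: n2; apply/andP.
  move=> [[|]|].
  - move=> [Ax /andP[? ?]]; rewrite ifT//; apply/andP; split; lra.
  - move=> [Ax /andP[? ?]]; rewrite ifF.
      by rewrite ifT//; apply/andP; split; lra.
    by apply/negbTE/negP => /andP[? ?]; lra.
  - move=> [Ax n]; rewrite ifF; last first.
      by apply/negbTE/negP => /andP[? ?]; apply: n; apply/andP; split; lra.
    by rewrite ifF//; apply/negbTE/negP => /andP[? ?]; apply: n; apply/andP; split; lra.
rewrite muU3; [|by apply: mS; exact: measurableI..|exact: measurableI| |].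
- rewrite !lebesgue_measure_shift; [|exact: measurableI..].
  rewrite -muU3; [|exact: measurableI..| |].
  (* After the translations are removed, the pieces reassemble to [A], since [J1], [J2] and [K]
     cover the line. *)
  + rewrite -!setIUr; congr (mu _).
    rewrite -[RHS]setIT; congr (_ `&` _); apply/seteqP; split => // x _.
    rewrite /J1 /J2 /K/= !in_itv/=.
    have [?|?] := ltP x (- (1 / 2)); first by right => /andP[? ?]; lra.
    have [?|?] := ltP x (1 / 2 - s); first by left; right.
    by have [?|?] := ltP x (1 / 2); [left; left|right => /andP[]].
  + apply/seteqP; split => // x; rewrite /J1 /J2/= !in_itv/=.
    by move=> [[_ /andP[? ?]] [_ /andP[? ?]]]; lra.
  + apply/seteqP; split => // x; rewrite /J1 /J2 /K/= !in_itv/=.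
    by move=> [[|] [_ /andP[? ?]] [_]]; apply; apply/andP; split; lra.
- apply/seteqP; split => // x; rewrite /J1 /J2/= !in_itv/=.
  by move=> [[_ /andP[? ?]] [_ /andP[? ?]]]; lra.
- apply/seteqP; split => // x; rewrite /J1 /J2 /K/= !in_itv/=.
  by move=> [[|] [_ /andP[? ?]] [_]]; apply; apply/andP; split; lra.
Qed.

End interval_exchange.

(** * Translation modulo the lattice and integrals of periodic functions *)

Section torus_shift.
Context {R : realType} {d : nat}.
Local Notation L := (@lebesgue_tuple R d).
Local Notation pt := (pointR R d).
Implicit Types (x y : pt) (F : pt -> R) (k : 'rV[int]_d).

(** Unlike the open [cell], it contains exactly one representative of each class modulo the lattice,
    so translations modulo the lattice act on it. *)
Definition half_open_cell : set pt :=
  box (fun=> `[- (1 / 2), 1 / 2[%classic : set (measurableTypeR R)).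

Local Notation Q := half_open_cell.

Lemma measurable_half_open_cell : measurable Q.
Proof. by apply: measurable_box => _; exact: measurable_itv. Qed.

Lemma cellE : @cell R d =
  box (fun=> `]- (1 / 2), 1 / 2[%classic : set (measurableTypeR R)).
Proof. by apply/seteqP; split => x xc a; have := xc a; rewrite /= in_itv. Qed.

Lemma measurable_cell : measurable (@cell R d).
Proof. by rewrite cellE; apply: measurable_box => _; exact: measurable_itv. Qed.

Lemma cell_sub_half_open_cell : @cell R d `<=` Q.
Proof.
by move=> x xc a; have /andP[/ltW x1 x2] := xc a; rewrite /= in_itv/= x1.
Qed.

Let lebesgue_unit_itv b :
  @lebesgue_measure R [set` Interval (BSide b (- (1 / 2))) (BLeft (1 / 2))] = 1%E.
Proof.
rewrite lebesgue_measure_itv/= lte_fin ifT; last lra.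
by rewrite -EFinB; congr EFin; field.
Qed.

Lemma lebesgue_half_open_cell : L Q = 1%E.
Proof.
rewrite [LHS]tuple_measure_box; last by move=> _; exact: measurable_itv.
by rewrite big1// => _ _; exact: lebesgue_unit_itv.
Qed.

(** The two cells are nested and both have measure 1. This null difference lets integrals pass from
    one cell to the other. *)
Lemma lebesgue_half_open_cellD : L (Q `\` @cell R d) = 0%E.
Proof.
have mQ := measurable_half_open_cell; have mC := measurable_cell.
have LQ : (L Q < +oo)%E by rewrite lebesgue_half_open_cell ltry.
rewrite [LHS]measureD//.
rewrite setIC setIidl; last exact: cell_sub_half_open_cell.
rewrite {1}cellE [X in (_ - X)%E]tuple_measure_box; last first.
  by move=> _; exact: measurable_itv.
rewrite big1; last by move=> _ _; exact: lebesgue_unit_itv.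
by rewrite [X in (X - _)%E]lebesgue_half_open_cell subee.
Qed.

(** [circle_shift] represents a translation only for shifts in [0, 1), hence the fractional parts of
    the coordinates of [y]; the integer parts do not change the class modulo the lattice. *)
Definition torus_shift y x : pt :=
  [tuple circle_shift (tnth y a - (Num.floor (tnth y a))%:~R) (tnth x a) | a < d].

Let fractional_part (r : R) : 0 <= r - (Num.floor r)%:~R < 1.
Proof.
rewrite subr_ge0 ge_floor/= ltrBlDr addrC -[ltRHS]/(_ + 1%:~R) -intrD.
exact: lt_succ_floor.
Qed.

Lemma torus_shift_measure_preserving y :
  measurable_fun [set: pt] (torus_shift y) /\
  (forall B, measurable B -> L (torus_shift y @^-1` B) = L B).
Proof.
apply: (@tuple_measure_map _ _ _ (@lebesgue_measure R) d (fun a => circle_shift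
    (tnth y a - (Num.floor (tnth y a))%:~R))) => [a|a B mB].
  exact: measurable_circle_shift.
by apply: lebesgue_measure_circle_shift => //; exact: fractional_part.
Qed.

Lemma preimage_torus_shift y : torus_shift y @^-1` Q = Q.
Proof.
by apply/seteqP; split => x xQ a; have := xQ a;
  rewrite /= tnth_mktuple circle_shift_half_open// fractional_part.
Qed.

Lemma torus_shift_congr y x : Q x ->
  exists k, tsub x y = translate (torus_shift y x) k.
Proof.
move=> xQ; have /choice[z zE] a := circle_shift_congr
  (tnth y a - (Num.floor (tnth y a))%:~R) (xQ a).
(* This vector undoes both the dropped integer part of [y] and the wrap-around [z] of the interval
   exchange. *)
exists (\row_a (- Num.floor (tnth y a) - z a)).
apply: eq_from_tnth => a; rewrite !tnth_mktuple /xcoord tnth_mktuple zE mxE.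
by rewrite intrB rmorphN/=; ring.
Qed.

Lemma integrable_cell F : L.-integrable Q (EFin \o F) ->
  L.-integrable (@cell R d) (EFin \o F).
Proof.
apply: integrableS; [exact: measurable_half_open_cell|exact: measurable_cell|].
exact: cell_sub_half_open_cell.
Qed.

Lemma Rintegral_cell F : L.-integrable Q (EFin \o F) ->
  \int[L]_(x in @cell R d) F x = \int[L]_(x in Q) F x.
Proof.
have mQ := measurable_half_open_cell; have mC := measurable_cell.
move=> iF; congr fine; rewrite [RHS](@negligible_integral _ _ _ _ Q (Q `\` @cell R d))//.
- by rewrite setDD setIC setIidl//; exact: cell_sub_half_open_cell.
- exact: measurableD.
- exact: lebesgue_half_open_cellD.
Qed.

Lemma measurable_tsub y : measurable_fun [set: pt] (fun x => tsub x y).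
Proof.
apply/measurable_fun_tnthP => a.
rewrite (_ : _ \o _ = (fun u : measurableTypeR R => u + - xcoord y a)
   \o (@tnth d (measurableTypeR R))^~ a); last first.
  by apply/funext => x /=; rewrite tnth_mktuple.
by apply: measurableT_comp; [exact: measurable_shift|exact: measurable_tnth].
Qed.

(** The lattice vector relating [tsub x y] to [torus_shift y x] varies with [x], so one null set
    must serve all lattice vectors; countability of the lattice provides it. Its preimage under
    [torus_shift y] is again null. *)
Lemma periodic_ae_shift F y :
  (forall k, {ae L, forall x, F (translate x k) = F x}) ->
  {ae L, forall x, Q x -> F (tsub x y) = F (torus_shift y x)}.
Proof.
move=> Fper; have [mT presT] := torus_shift_measure_preserving y.
(* The lattice is enumerated by the naturals through [unpickle]; a natural that encodes no vector is
   sent to 0, which is harmless. *)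
have : {ae L, forall x, forall n, F (translate x (odflt 0 (unpickle n))) = F x}.
  by apply: ae_foralln => n; exact: Fper.
move=> [N [mN N0 sN]]; exists (torus_shift y @^-1` N); split.
- by rewrite -[X in measurable X]setTI; exact: mT.
- by rewrite presT.
- move=> x /= nx; apply: sN => /= xper; apply: nx => Qx.
  have [k ->] := torus_shift_congr y Qx.
  by have := xper (pickle k); rewrite pickleK.
Qed.

(** Almost everywhere on [Q] the translate of [F] equals [F \o torus_shift y], whose integral is
    found by a change of variables along a measure-preserving map that fixes [Q] as a set. *)
Lemma periodic_integral_shift F y : measurable_fun [set: pt] F ->
  (forall k, {ae L, forall x, F (translate x k) = F x}) ->
  L.-integrable Q (EFin \o F) ->
  L.-integrable Q (EFin \o (fun x => F (tsub x y))) /\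
  \int[L]_(x in Q) F (tsub x y) = \int[L]_(x in Q) F x.
Proof.
move=> mF Fper iF; have [mT presT] := torus_shift_measure_preserving y.
have mQ := measurable_half_open_cell.
have mE (g : pt -> R) : measurable_fun setT g -> measurable_fun Q (EFin \o g).
  by move=> mg; apply/measurable_EFinP; exact: measurable_funTS.
have mFs : measurable_fun setT (fun x => F (tsub x y)).
  by apply: measurableT_comp => //; exact: measurable_tsub.
have mFT : measurable_fun setT (F \o torus_shift y) by exact: measurableT_comp.
have aeF := periodic_ae_shift y Fper.
(* The change of variables for signed functions presupposes integrability, obtained here from its
   nonnegative version applied to the absolute value of [F]. *)
have iFT : L.-integrable Q (EFin \o (F \o torus_shift y)).
  apply/integrableP; split; first exact: mE.
  move/integrableP : iF => [_]; apply: le_lt_trans.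
  rewrite [leRHS](_ : _ =
      (\int[pushforward L (torus_shift y)]_(x in Q) `|(EFin \o F) x|)%E).
    rewrite ge0_integral_pushforward//; first by rewrite preimage_torus_shift.
    by apply: measurableT_comp => //; exact: mE.
  by apply: eq_measure_integral => B mB _; exact/esym/presT.
split.
  apply/integrableP; split; first exact: mE.
  move/integrableP : iFT => [_]; apply: le_lt_trans.
  rewrite le_eqVlt; apply/orP; left; apply/eqP; apply: ae_eq_integral => //.
  - by apply: measurableT_comp => //; exact: mE.
  - by apply: measurableT_comp => //; exact: mE.
  - by apply: filterS aeF => x /= + Qx => ->.
transitivity (\int[L]_(x in Q) (F \o torus_shift y) x).
  congr fine; apply: ae_eq_integral => //; [exact: mE|exact: mE|].
  by apply: filterS aeF => x /= + Qx => ->.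
congr fine; transitivity
    (\int[pushforward L (torus_shift y)]_(x in Q) (EFin \o F) x)%E.
  rewrite integral_pushforward//; first by rewrite preimage_torus_shift.
    by apply/measurable_EFinP.
  by rewrite preimage_torus_shift.
by apply: eq_measure_integral => B mB _; exact: presT.
Qed.

End torus_shift.

(** * Linearity and shift invariance of the complex integral *)

Section complex_integral.
Context {R : realType} {d : nat}.
Local Notation L := (@lebesgue_tuple R d).
Local Notation pt := (pointR R d).
Implicit Types (D : set pt) (f g : pt -> R[i]).

Definition cintegrable D f :=
  L.-integrable D (EFin \o (fun x => complex.Re (f x))) /\
  L.-integrable D (EFin \o (fun x => complex.Im (f x))).

Lemma eq_cintegral D f g : {in D, f =1 g} -> cintegral D f = cintegral D g.
Proof.
by move=> fg; congr (_ +i* _); apply: eq_Rintegral => x xD; rewrite fg.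
Qed.

Lemma cintegrableD D f g : measurable D -> cintegrable D f -> cintegrable D g ->
  cintegrable D (fun x => f x + g x) /\
  cintegral D (fun x => f x + g x) = cintegral D f + cintegral D g.
Proof.
move=> mD [f1 f2] [g1 g2].
have ReD x : complex.Re (f x + g x) = complex.Re (f x) + complex.Re (g x).
  by case: (f x) (g x) => ? ? [].
have ImD x : complex.Im (f x + g x) = complex.Im (f x) + complex.Im (g x).
  by case: (f x) (g x) => ? ? [].
split.
  by split; [under [_ \o _]funext do rewrite /= ReD EFinD|
    under [_ \o _]funext do rewrite /= ImD EFinD]; exact: integrableD.
rewrite /cintegral; under eq_Rintegral do rewrite ReD.
by under [X in _ +i* X]eq_Rintegral do rewrite ImD; rewrite !RintegralD.
Qed.

Lemma cintegrableZ D f (z : R[i]) : measurable D -> cintegrable D f ->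
  cintegrable D (fun x => z * f x) /\
  cintegral D (fun x => z * f x) = z * cintegral D f.
Proof.
case: z => a b mD [f1 f2].
have ReM x : complex.Re ((a +i* b) * f x) =
    a * complex.Re (f x) - b * complex.Im (f x) by case: (f x).
have ImM x : complex.Im ((a +i* b) * f x) =
    a * complex.Im (f x) + b * complex.Re (f x) by case: (f x).
have iZ c (h : pt -> R) : L.-integrable D (EFin \o h) ->
    L.-integrable D (EFin \o (fun x => c * h x)).
  by move=> ih; under [_ \o _]funext do rewrite /= EFinM; exact: integrableZl.
have ia1 := iZ a _ f1; have ib1 := iZ b _ f1.
have ia2 := iZ a _ f2; have ib2 := iZ b _ f2.
split.
  split.
    by under [_ \o _]funext do rewrite /= ReM EFinB; exact: integrableB.
  by under [_ \o _]funext do rewrite /= ImM EFinD; exact: integrableD.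
rewrite /cintegral; under eq_Rintegral do rewrite ReM.
under [X in _ +i* X]eq_Rintegral do rewrite ImM.
by rewrite RintegralB// RintegralD// !RintegralZl.
Qed.

Lemma cintegral_sum D (I : Type) (s : seq I) (f : I -> pt -> R[i]) :
  measurable D -> (forall i, cintegrable D (f i)) ->
  cintegral D (fun x => \sum_(i <- s) f i x) = \sum_(i <- s) cintegral D (f i).
Proof.
move=> mD fi.
(* Additivity needs integrable summands, so the induction carries integrability of the partial
   sums. *)
suff [_ ->//] : cintegrable D (fun x => \sum_(i <- s) f i x) /\
  cintegral D (fun x => \sum_(i <- s) f i x) = \sum_(i <- s) cintegral D (f i).
elim: s => [|i s [ints eqs]].
  rewrite big_nil; under [X in cintegrable _ X]funext do rewrite big_nil.
  under eq_cintegral do rewrite big_nil.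
  split; first by split; exact: integrable0.
  by rewrite /cintegral !Rintegral_cst// !mul0r.
rewrite big_cons -eqs; under [X in cintegrable _ X]funext do rewrite big_cons.
by under eq_cintegral do rewrite big_cons; exact: cintegrableD.
Qed.

(** Real and imaginary parts inherit periodicity. Integrability is assumed on the half-open cell,
    where the shift acts, and the conclusion is on the open cell, over which Fourier coefficients
    are taken. *)
Lemma periodic_cintegral_shift f (y : pt) :
  measurable_fun [set: pt] (fun x => complex.Re (f x)) ->
  measurable_fun [set: pt] (fun x => complex.Im (f x)) ->
  (forall k, {ae L, forall x, f (translate x k) = f x}) ->
  cintegrable half_open_cell f ->
  cintegrable (@cell R d) (fun x => f (tsub x y)) /\
  cintegral (@cell R d) (fun x => f (tsub x y)) = cintegral (@cell R d) f.
Proof.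
move=> mRe mIm fper [iRe iIm].
have [jRe eRe] := periodic_integral_shift y mRe
  (fun k => filterS (fun x fx => congr1 (@complex.Re R) fx) (fper k)) iRe.
have [jIm eIm] := periodic_integral_shift y mIm
  (fun k => filterS (fun x fx => congr1 (@complex.Im R) fx) (fper k)) iIm.
split; first by split; exact: integrable_cell.
by rewrite /cintegral !Rintegral_cell// eRe eIm.
Qed.

End complex_integral.

(** * Characters of the torus *)

Section characters.
Context {R : realType} {d : nat}.
Local Notation pt := (pointR R d).
Implicit Types (r s : R) (x y : pt) (k : 'rV[int]_d).

(** The map sending r to exp(2 pi i r). Both [phi] and [omega] unfold to [cis] of a real phase, so
    their identities reduce to identities between phases. *)
Definition cis r : R[i] := cexp (2 * pi%:C * 'i * r%:C).

Lemma cisE r : cis r = cos (2 * pi * r) +i* sin (2 * pi * r).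
Proof.
rewrite /cis (_ : _ * r%:C = 0 +i* (2 * pi * r)).
  by rewrite /cexp /= expR0 mul1r.
rewrite (_ : (2 : R[i]) = 2%:C); last by apply/eqP; rewrite eq_complex /= addr0 !eqxx.
by simpc.
Qed.

Lemma cisD r s : cis (r + s) = cis r * cis s.
Proof. by rewrite !cisE mulrDr cosD sinD; simpc; congr (_ +i* _); ring. Qed.

Lemma cis0 : cis 0 = 1.
Proof. by rewrite cisE mulr0 cos0 sin0. Qed.

(** Induction on naturals, adding the period 2 pi as two half-periods; a negative integer follows by
    multiplying with [cis] of its opposite. *)
Lemma cis_int (z : int) : cis z%:~R = 1.
Proof.
have cis_nat n : cis n%:R = 1.
  elim: n => [|n IHn]; first exact: cis0.
  rewrite -natr1 cisD IHn mul1r cisE mulr1 mulr_natl.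
  by rewrite (mulr2n pi) cosDpi sinDpi cospi sinpi opprK oppr0.
have [n [->|->]] : exists n : nat, z = n \/ z = - n%:Z.
- by case: z => n; [exists n; left|exists n.+1; right].
- exact: cis_nat.
- by rewrite -[LHS]mul1r -[in LHS](cis_nat n) -cisD rmorphN/= subrr cis0.
Qed.

Lemma phi_tsub k x y : phi k x = phi k y * phi k (tsub x y).
Proof.
rewrite -cisD -big_split/=; congr cis; apply: eq_bigr => a _.
by rewrite -mulrDr /xcoord tnth_mktuple addrC subrK.
Qed.

Lemma phi_translate k x (m : 'rV[int]_d) : phi k (translate x m) = phi k x.
Proof.
rewrite -[RHS]mulr1 -(cis_int (\sum_a k 0 a * m 0 a)) -cisD; congr cis.
rewrite rmorph_sum/= -big_split/=; apply: eq_bigr => a _.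
by rewrite /xcoord tnth_mktuple mulrDr intrM.
Qed.

Lemma phi_gridpt k (P : 'I_d -> nat) p : phi k (gridpt P p) = omega P k p :> R[i].
Proof.
by congr cis; apply: eq_bigr => a _; rewrite /xcoord tnth_mktuple intrM mulrA.
Qed.

Lemma measurable_phase k :
  measurable_fun [set: pt] (fun x => 2 * pi * \sum_a (k 0 a)%:~R * xcoord x a).
Proof.
apply: measurable_funM => //; apply: measurable_sum => a.
by apply: measurable_funM => //; exact: measurable_tnth.
Qed.

End characters.

(** * Fourier coefficients of a translate *)

Section fourier_shift.
Context {R : realType} {d : nat}.
Local Notation L := (@lebesgue_tuple R d).
Local Notation pt := (pointR R d).
Variables (psi : pt -> R) (psiP : Linfty_per psi).

Lemma Linfty_per_bounded : exists c : R, 0 <= c /\ {ae L, forall x, `|psi x| <= c}.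
Proof.
have [mpsi npsi _] := psiP.
(* The sup norm unfolds to an essential supremum under the condition that the whole space has
   positive measure. *)
have L0 : (0 < L setT)%E.
  apply: (@lt_le_trans _ _ (L half_open_cell)).
    by rewrite lebesgue_half_open_cell.
  by apply: le_measure; rewrite ?inE//; exact: measurable_half_open_cell.
move: npsi; rewrite /finite_norm unlock /Lnorm L0 => npsi.
have [c cP] := ess_supr_bounded npsi.
exists `|c|; split => //; apply: filterS cP => x /= xc.
exact: le_trans xc (ler_norm c).
Qed.

(** The product is measurable and almost everywhere bounded, on a set of measure 1. *)
Lemma integrable_Linfty_perM (h : pt -> R) : measurable_fun [set: pt] h ->
  (forall x, `|h x| <= 1) ->
  L.-integrable half_open_cell (EFin \o (fun x => psi x * h x)).
Proof.
move=> mh h1; have [c [c0 cP]] := Linfty_per_bounded.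
have [mpsi _ _] := psiP.
have mQ := @measurable_half_open_cell R d.
have mph : measurable_fun half_open_cell (EFin \o (fun x => psi x * h x)).
  apply/measurable_EFinP; apply: measurable_funTS; exact: measurable_funM.
apply/integrableP; split => //.
apply: (@le_lt_trans _ _ (c%:E * L half_open_cell)%E).
  apply: integral_le_bound => //; apply: filterS cP => x /= xc _.
  by rewrite lee_fin normrM -[leRHS]mulr1 ler_pM.
by rewrite lebesgue_half_open_cell mule1 ltry.
Qed.

(** The character splits as its value at [y] times its value at [tsub x y]. Hence [F] is a constant
    times the translate of [G], which is periodic almost everywhere, and translation does not change
    the integral of [G]. *)
Lemma fourier_shift (y : pt) (n : 'rV[int]_d) :
  let F x := (psi (tsub x y))%:C * phi (- n) x in
  cintegrable (@cell R d) F /\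
  cintegral (@cell R d) F = phi (- n) y * fourier (fun x => (psi x)%:C) n.
Proof.
move=> F; pose G x : R[i] := (psi x)%:C * phi (- n) x.
have FE : F = (fun x => phi (- n) y * G (tsub x y)).
  by apply/funext => x; rewrite /F /G (phi_tsub _ x y) mulrCA.
(* With this phase, the real and imaginary parts of [G] are [psi] times a cosine and a sine, both
   bounded by 1. *)
pose t (x : pt) := 2 * pi * \sum_a ((- n) 0 a)%:~R * xcoord x a : R.
have mt : measurable_fun [set: pt] t := measurable_phase (- n).
have ReG : (fun x => complex.Re (G x)) = (fun x => psi x * cos (t x)).
  by apply/funext => x; rewrite /G [phi _ _]cisE /= mul0r subr0.
have ImG : (fun x => complex.Im (G x)) = (fun x => psi x * sin (t x)).
  by apply/funext => x; rewrite /G [phi _ _]cisE /= mul0r addr0.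
have mcos : measurable_fun [set: pt] (fun x => cos (t x)).
  by apply: measurableT_comp => //; apply: continuous_measurable_fun; exact: continuous_cos.
have msin : measurable_fun [set: pt] (fun x => sin (t x)).
  by apply: measurableT_comp => //; apply: continuous_measurable_fun; exact: continuous_sin.
have [mpsi _ psiper] := psiP.
have [| |k| |iG eG] := @periodic_cintegral_shift _ _ G y.
- by rewrite ReG; exact: measurable_funM.
- by rewrite ImG; exact: measurable_funM.
- by apply: filterS (psiper k) => x; rewrite /G phi_translate => ->.
- split.
    rewrite ReG; apply: integrable_Linfty_perM => // x.
    by rewrite ler_norml cos_geN1 cos_le1.
  rewrite ImG; apply: integrable_Linfty_perM => // x.
  by rewrite ler_norml sin_geN1 sin_le1.
rewrite FE; have [iZ ->] := cintegrableZ (phi (- n) y) (@measurable_cell R d) iG.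
by rewrite eG.
Qed.

End fourier_shift.

(** * Fourier coefficients of the grid sum and the final formula *)

(** A vanishing component of [P] would require a coordinate that is both nonnegative and negative.
    This handles the case where dividing by [msize P] is meaningless. *)
Lemma Zgrid_msize0 (d : nat) (P : 'I_d -> nat) : msize P = 0%N -> Zgrid P = set0.
Proof.
move=> /eqP; rewrite prod_nat_seq_eq0 => /hasP[a _ /= /eqP Pa0].
apply/seteqP; split => // p /(_ a); rewrite Pa0 mul0r oppr0 => -[p0].
by rewrite ltNge p0.
Qed.

Lemma fourier_mx_grid_sum (R : realType) (d : nat) (P : 'I_d -> nat)
    (psi : pointR R d -> R) (C : 'rV[int]_d -> 'M[R]_d)
    (A : pointR R d -> 'M[R]_d) (n : 'rV[int]_d) (a b : 'I_d) :
  Linfty_per psi ->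
  (forall x, cell x ->
    A x = \sum_(p \in Zgrid P) psi (tsub x (gridpt P p)) *: C p) ->
  fourier_mx A n a b = fourier (fun x => (psi x)%:C) n *
    \sum_(p \in Zgrid P) omega P (- n) p * (C p a b)%:C.
Proof.
move=> psiP AE; have fP := finite_Zgrid P.
pose F p (x : pointR R d) := (psi (tsub x (gridpt P p)))%:C * phi (- n) x.
(* The integral runs over [cell], where the formula for [A] may be substituted. *)
rewrite mxE [in LHS]/fourier (@eq_cintegral _ _ _ _
  (fun x => \sum_(p <- finmap.enum_fset (fset_set (Zgrid P))) (C p a b)%:C * F p x)); last first.
  move=> x /[!inE] /AE ->; rewrite fsbig_finite//= summxE rmorph_sum/= mulr_suml.
  by apply: eq_bigr => p _; rewrite mxE rmorphM/= mulrAC mulrC.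
have iF p := fourier_shift psiP (gridpt P p) n.
have iCF p := cintegrableZ (C p a b)%:C (@measurable_cell R d) (proj1 (iF p)).
rewrite cintegral_sum; [|exact: measurable_cell|by move=> p; have [] := iCF p].
rewrite fsbig_finite//= mulr_sumr; apply: eq_bigr => p _.
(* The shift rule at the grid point of [p] yields the factor [omega P (- n) p]. *)
by rewrite (proj2 (iCF p)) (proj2 (iF p)) phi_gridpt; ring.
Qed.

Theorem lemma18 (R : realType) (d : nat) (hd : d = 2%N \/ d = 3%N)
    (N M P : 'I_d -> nat)
    (hN : forall a, odd (N a))
    (hM : forall a, (2 * N a - 1 <= M a)%N)
    (psi : pointR R d -> R) (hpsi : Linfty_per psi)
    (C : 'rV[int]_d -> 'M[R]_d)
    (A : pointR R d -> 'M[R]_d)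
    (hA : forall x, cell x ->
      A x = \sum_(p \in Zgrid P) psi (tsub x (gridpt P p)) *: C p)
    (k l : 'rV[int]_d) (hk : Zgrid M k) (hl : Zgrid M l) (a b : 'I_d) :
  A_M N M A k l a b =
  (k == l)%:R * (msize P)%:R *
    \sum_(m \in Zgrid (twoN1 N))
      omega M k m * fourier (fun x => (psi x)%:C) m *
      (\sum_(p \in Zgrid P)
         omega P (- m) p / (msize P)%:R * (C p a b)%:C).
Proof.
(* The Kronecker factor is common to both sides; the sums over frequencies are then compared term by
   term. *)
rewrite /A_M -mulrA; congr (_ * _).
rewrite !(fsbig_finite _ _ (finite_Zgrid (twoN1 N)))/= mulr_sumr.
apply: eq_bigr => m _.
rewrite (fourier_mx_grid_sum _ _ _ hpsi hA) [LHS]mulrA [RHS]mulrCA; congr (_ * _).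
(* If [msize P] is 0, the grid is empty and both sides vanish; otherwise [msize P] cancels against
   the denominators. *)
have [P0|P0] := eqVneq (msize P) 0%N.
  by rewrite Zgrid_msize0// !fsbig_set0 mulr0.
rewrite !(fsbig_finite _ _ (finite_Zgrid P))/= mulr_sumr.
by apply: eq_bigr => p _; field; rewrite pnatr_eq0.
Qed.
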